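(* Let $\epsilon$ be the teleport probability with $0<\epsilon<\frac{1}{3}$, and let $R\ge 1$ be the number of walks stored per node. There is a family of directed graphs, with $n$ nodes and $m=n-1$ edges for arbitrarily large $n$, and an arrival order of their edges, such that when the incremental Monte Carlo PageRank algorithm described in the context processes the $m$ edge arrivals, the expected total number of walk segments updated is \[\Omega\left(R\, n\, m^{\log_2\left(\frac{3}{2}(1-\epsilon)\right)}\right).\]
   Context: Incremental Monte Carlo PageRank (Bahmani–Chowdhury–Goel). All $n$ nodes of a directed graph are present from the start; the $m$ edges arrive one at a time in an order fixed in advance (here chosen by an adversary). The algorithm maintains, for every node, $R$ random walks starting at that node, generated as follows: after each step the walk terminates with probability $\epsilon$ (the teleport probability), so its length is geometric with mean $1/\epsilon$; with the remaining probability $1-\epsilon$ it moves to an out-neighbor of the current node chosen uniformly at random among the out-neighbors present in the current graph; if the current node has out-degree $0$, the walk instead moves back to its starting node and continues from there. When a new edge $(u,v)$ arrives, let $d(u)$ be the new out-degree of $u$. For each stored walk passing through $u$, independently with probability $1/d(u)$, the part of the walk after $u$ is discarded and a new remainder is generated starting at $v$ (with the same rule), preserving the total length of the original walk; each such regeneration counts as one updated walk segment. The quantity bounded is the expected total number of updated walk segments over all $m$ arrivals. The constant in $\Omega$ may depend on $\epsilon$. *)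

(* Defs.v *)
From HB Require Import structures.
From mathcomp Require Import all_boot all_order all_algebra.
From mathcomp Require Import all_classical all_reals all_analysis.

Set Implicit Arguments.
Unset Strict Implicit.
Unset Printing Implicit Defensive.

Import Order.TTheory GRing.Theory Num.Theory.

Local Open Scope classical_set_scope.
Local Open Scope ring_scope.
Local Open Scope ereal_scope.

(* Discrete laws, represented by their probability mass functions. *)
Definition law (R : realType) (A : choiceType) : Type := A -> \bar R.

Definition ret (R : realType) (A : choiceType) (a : A) : law R A :=
  fun x => ((x == a)%:R : R)%:E.

Definition bind (R : realType) (A B : choiceType)
    (p : law R A) (k : A -> law R B) : law R B :=
  fun b => \esum_(a in [set: A]) (p a * k a b).

Definition lmap (R : realType) (A B : choiceType) (f : A -> B) (p : law R A) :
    law R B :=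
  bind p (fun a => ret R (f a)).

(* Joint law of independent variables indexed by a finite type. *)
Definition indep (R : realType) (I : finType) (A : choiceType)
    (p : I -> law R A) :
    law R {ffun I -> A} :=
  fun f => \prod_(i : I) p i (f i).

Definition expect (R : realType) (A : choiceType) (p : law R A) (X : A -> R) :
    \bar R :=
  \esum_(a in [set: A]) (p a * (X a)%:E).

Definition coin (R : realType) (p : R) : law R bool :=
  fun b => (bernoulli_pmf p b)%:E.

Definition unif (R : realType) (A : choiceType) (s : seq A) : law R A :=
  fun x => ((count_mem x s)%:R / (size s)%:R : R)%:E.

(* Supported on {1, 2, ...}, with mean 1 / eps. *)
Definition geom (R : realType) (eps : R) : law R nat :=
  fun l => (if l is k.+1 then eps * (1 - eps) ^+ k else 0 : R)%R%:E.

(* The nodes are 'I_n; a graph is the sequence of its edges (u, v), meaning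
   u -> v, and an arrival order of its edges is such a sequence, read from left
   to right. *)
Definition edge (n : nat) : Type := ('I_n * 'I_n)%type.

Definition simple_digraph (n : nat) (es : seq (edge n)) : bool :=
  uniq es && all (fun e => e.1 != e.2) es.

Definition out_nbrs (n : nat) (es : seq (edge n)) (u : 'I_n) : seq 'I_n :=
  [seq e.2 | e <- es & e.1 == u].

Definition out_deg (n : nat) (es : seq (edge n)) (u : 'I_n) : nat :=
  size (out_nbrs es u).

Definition step (R : realType) (n : nat) (es : seq (edge n)) (s u : 'I_n) :
    law R 'I_n :=
  if out_deg es u == 0%N then ret R s else unif R (out_nbrs es u).

(* The next k nodes of a walk that started at s and is currently at u. *)
Fixpoint moves (R : realType) (n : nat) (es : seq (edge n)) (s u : 'I_n)
    (k : nat) {struct k} : law R (seq 'I_n) :=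
  if k is k'.+1 then
    bind (step R es s u) (fun v => lmap (cons v) (moves R es s v k'))
  else ret R [::].

(* A walk is the sequence of the nodes it visits, its starting node included.
   The decision to stop (with probability eps) is taken at every visited node,
   so that the number of visited nodes is geometric with mean 1 / eps. *)
Definition fresh_walk (R : realType) (n : nat) (eps : R) (es : seq (edge n))
    (s : 'I_n) : law R (seq 'I_n) :=
  bind (geom eps) (fun l => lmap (cons s) (moves R es s s l.-1)).

(* Effect on the walk w, started at s, of the arrival of e = (u, v), where es
   is the graph with e included. The walk is cut after its first visit to u; a
   walk that does not visit u, or does so only at its last node, has no part
   after u and is left alone. The boolean tells whether w was regenerated. *)
Definition update_walk (R : realType) (n : nat) (es : seq (edge n))
    (e : edge n) (s : 'I_n) (w : seq 'I_n) : law R (seq 'I_n * bool)%type :=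
  let: (u, v) := e in
  let i := index u w in
  if (i.+1 < size w)%N then
    bind (coin ((out_deg es u)%:R^-1 : R)) (fun b =>
      if b then
        lmap (fun t => (take i.+1 w ++ v :: t, true))
             (moves R es s v (size w - i.+2))
      else ret R (w, false))
  else ret R (w, false).

(* The stored walk of index (s, j) is the j-th walk starting at s. *)
Definition store (n Rw : nat) : Type := {ffun 'I_n * 'I_Rw -> seq 'I_n}.

Definition init_store (R : realType) (n Rw : nat) (eps : R) :
    law R (store n Rw) :=
  indep (fun sj => fresh_walk eps [::] sj.1).

(* The second component of x counts the walk segments updated so far. *)
Definition arrival (R : realType) (n Rw : nat) (es : seq (edge n))
    (e : edge n) (x : store n Rw * nat) : law R (store n Rw * nat)%type :=
  lmap (fun y : {ffun 'I_n * 'I_Rw -> seq 'I_n * bool} =>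
          ([ffun sj => (y sj).1], (x.2 + #|[pred sj | (y sj).2]|)%N))
       (indep (fun sj => update_walk R es e sj.1 (x.1 sj))).

Fixpoint run (R : realType) (n Rw : nat) (past future : seq (edge n))
    (x : store n Rw * nat) {struct future} : law R (store n Rw * nat)%type :=
  if future is e :: future' then
    let es := rcons past e in
    bind (arrival R es e x) (run R es future')
  else ret R x.

Definition expected_updates (R : realType) (n Rw : nat) (eps : R)
    (order : seq (edge n)) : \bar R :=
  expect (bind (@init_store R n Rw eps) (fun st => run R [::] order (st, 0%N)))
         (fun x => x.2%:R).

Definition log2 (R : realType) (x : R) : R := (ln x / ln 2)%R.

(* Main.v *)
Require Import Defs.
From HB Require Import structures.
From mathcomp Require Import all_boot all_order all_algebra.
From mathcomp Require Import all_classical all_reals all_analysis.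
From mathcomp Require Import zify ring lra.

(* About half of the nodes first get an edge to a common root; then a complete
   binary tree of depth [k] is grown below the root in preorder, each edge
   arriving right before the whole subtree below it.  Consider a walk with at
   least [k + 2] nodes started at a leaf of the star, and fix its length.
   If it passes through the root of the current subtree, the first edge out of
   that root regenerates it and sends it to the left subtree; the second edge
   regenerates it again with probability 1/2 and sends it to the right subtree.
   The number of regenerations thus obeys U(k) >= 3/2 (1 + U(k - 1)), so that
   U(k) >= (3/2)^k - 1; the required length has probability (1 - eps)^(k + 1).
   Only the first descent of the walk is tracked: it is never altered by an edge
   leaving a node off the descent, whatever the walk does after it has returned
   to its starting node. *)

Import Order.TTheory GRing.Theory Num.Theory.
Local Open Scope ring_scope.

Set Implicit Arguments.
Unset Strict Implicit.
Unset Printing Implicit Defensive.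
Local Open Scope classical_set_scope.
Local Open Scope ereal_scope.

(** * Sums of nonnegative extended reals over arbitrary index sets *)

(** One inequality, [le_mul], holds for every nonnegative constant; for finite [c > 0] the other one
    is [le_mul] applied to the inverse of [c]. For infinite [c], a single nonzero term already makes
    the sum infinite. *)
Lemma esumZl (R : realType) (T : choiceType) (I : set T) (c : \bar R)
    (a : T -> \bar R) :
  0 <= c -> (forall i, 0 <= a i) ->
  \esum_(i in I) (c * a i) = c * \esum_(i in I) a i.
Proof.
move=> c0 a0.
have le_mul (d : \bar R) (b : T -> \bar R) : 0 <= d -> (forall i, 0 <= b i) ->
    \esum_(i in I) (d * b i) <= d * \esum_(i in I) b i.
  move=> d0 b0; apply: ge_ereal_sup => _ [X [finX XI] <-].
  rewrite -ge0_mule_fsumr//; apply: lee_wpmul2l => //.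
  by apply: ereal_sup_ubound; exists X.
apply/eqP; rewrite eq_le le_mul//=.
have [->|cn0] := eqVneq c 0.
  by rewrite mul0e; apply: esum_ge0 => i _; rewrite mul0e.
have {cn0} : 0 < c by rewrite lt0e cn0.
case: c c0 => [c| |] // c0 cp; last first.
  have [az|/existsNP[i /not_implyP[Ii /eqP ai0]]] :=
      pselect (forall i, I i -> a i = 0).
    by rewrite (esum1 az) mule0; apply: esum_ge0 => i _; exact: mule_ge0.
  apply: (@le_trans _ _ +oo); first exact: leey.
  apply: esum_ge; exists [set i]; first by split=> // j ->.
  by rewrite fsbig_set1 gt0_mulye// lt0e ai0 a0.
rewrite -lee_pdivlMl//; apply: le_trans (le_mul _ _ _ _) => //.
- apply: le_esum => i _; rewrite muleA -EFinM mulVf ?mul1e//.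
  by rewrite gt_eqF.
- by rewrite lee_fin invr_ge0.
- by move=> i; exact: mule_ge0.
Qed.

Lemma exchange_esum (R : realType) (T1 T2 : choiceType)
    (a : T1 -> T2 -> \bar R) : (forall i j, 0 <= a i j) ->
  \esum_(i in [set: T1]) \esum_(j in [set: T2]) a i j =
  \esum_(j in [set: T2]) \esum_(i in [set: T1]) a i j.
Proof.
move=> a0; rewrite (esum_esum (J := fun=> setT))//.
rewrite (esum_esum (J := fun=> setT))//.
rewrite (reindex_esum ([set: T2] `*`` (fun=> [set: T1])) _
  (fun x => (x.2, x.1)))//; split=> //=.
- by move=> [i j] [k l] _ _ /= [-> ->].
- by move=> [i j] _; exists (j, i).
Qed.

Lemma esumT_single (R : realType) (T : choiceType) (t : T) (a : T -> \bar R) :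
  0 <= a t -> (forall i, i != t -> a i = 0) -> \esum_(i in [set: T]) a i = a t.
Proof.
move=> at0 a0; rewrite -(@esum_set1 _ _ t a)// [RHS]esum_mkcond.
apply: eq_esum => i _; case: ifPn => //; rewrite notin_setE /= => it.
by apply: a0; apply/eqP.
Qed.

Lemma esum_finType (R : realType) (T : finType) (a : T -> \bar R) :
  (forall i, 0 <= a i) -> \esum_(i in [set: T]) a i = \sum_(i : T) a i.
Proof.
move=> a0; have -> : [set: T] = [set` index_enum T].
  by apply/seteqP; split => i //= _; rewrite mem_index_enum.
rewrite esum_fset//.
by rewrite -fsbig_seq ?index_enum_uniq.
Qed.

(** * Expectations with respect to discrete laws *)

(** Unlike in [expect], the integrand is extended-real valued, so that an expectation can itself be
    integrated. *)
Definition Ex (R : realType) (A : choiceType) (p : law R A) (F : A -> \bar R) :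
    \bar R :=
  \esum_(a in [set: A]) (p a * F a).

(** The type [law] is that of all functions to the extended reals; this predicate carries
    nonnegativity and total mass 1. *)
Definition is_law (R : realType) (A : choiceType) (p : law R A) : Prop :=
  (forall a, 0 <= p a) /\ \esum_(a in [set: A]) p a = 1.

Lemma Ex_ge0 (R : realType) (A : choiceType) (p : law R A) (F : A -> \bar R) :
  (forall a, 0 <= p a) -> (forall a, 0 <= F a) -> 0 <= Ex p F.
Proof. by move=> p0 F0; apply: esum_ge0 => a _; exact: mule_ge0. Qed.

Lemma le_Ex (R : realType) (A : choiceType) (p : law R A) (F G : A -> \bar R) :
  (forall a, 0 <= p a) -> (forall a, F a <= G a) -> Ex p F <= Ex p G.
Proof. by move=> p0 FG; apply: le_esum => a _; exact: lee_wpmul2l. Qed.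

Lemma eq_Ex (R : realType) (A : choiceType) (p : law R A) (F G : A -> \bar R) :
  F =1 G -> Ex p F = Ex p G.
Proof. by move=> FG; apply: eq_esum => a _; rewrite FG. Qed.

Lemma Ex_add (R : realType) (A : choiceType) (p : law R A)
    (F G : A -> \bar R) :
  (forall a, 0 <= p a) -> (forall a, 0 <= F a) -> (forall a, 0 <= G a) ->
  Ex p (fun a => F a + G a) = Ex p F + Ex p G.
Proof.
move=> p0 F0 G0; rewrite /Ex -esumD; last 2 first.
- by move=> a _; exact: mule_ge0.
- by move=> a _; exact: mule_ge0.
by apply: eq_esum => a _; rewrite ge0_muleDr.
Qed.

Lemma Ex_sum (R : realType) (A : choiceType) (I : finType) (p : law R A)
    (F : I -> A -> \bar R) :
  (forall a, 0 <= p a) -> (forall i a, 0 <= F i a) ->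
  Ex p (fun a => \sum_(i : I) F i a) = \sum_(i : I) Ex p (F i).
Proof.
move=> p0 F0; rewrite /Ex -esum_sum; last by move=> a i _ _; exact: mule_ge0.
by apply: eq_esum => a _; rewrite ge0_sume_distrr.
Qed.

Lemma Ex_cst (R : realType) (A : choiceType) (p : law R A) (c : \bar R) :
  is_law p -> 0 <= c -> Ex p (fun=> c) = c.
Proof.
move=> [p0 p1] c0; rewrite /Ex; under eq_esum do rewrite muleC.
by rewrite esumZl// p1 mule1.
Qed.

Lemma Ex_ret (R : realType) (A : choiceType) (a : A) (F : A -> \bar R) :
  (forall a, 0 <= F a) -> Ex (ret R a) F = F a.
Proof.
move=> F0; rewrite /Ex /ret (esumT_single (t := a)).
- by rewrite eqxx mul1e.
- by rewrite eqxx mul1e.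
- by move=> b /negPf ->; rewrite mul0e.
Qed.

Lemma ret_law (R : realType) (A : choiceType) (a : A) : is_law (ret R a).
Proof.
split=> [b|]; first by rewrite lee_fin.
rewrite -[RHS](@Ex_ret R A a (fun=> 1))//.
by apply: eq_esum => b _; rewrite mule1.
Qed.

Lemma bind_ge0 (R : realType) (A B : choiceType) (p : law R A)
    (k : A -> law R B) :
  (forall a, 0 <= p a) -> (forall a b, 0 <= k a b) ->
  forall b, 0 <= bind p k b.
Proof. by move=> p0 k0 b; apply: esum_ge0 => a _; exact: mule_ge0. Qed.

Lemma Ex_bind (R : realType) (A B : choiceType) (p : law R A)
    (k : A -> law R B) (F : B -> \bar R) :
  (forall a, 0 <= p a) -> (forall a b, 0 <= k a b) -> (forall b, 0 <= F b) ->
  Ex (bind p k) F = Ex p (fun a => Ex (k a) F).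
Proof.
move=> p0 k0 F0; rewrite /Ex /bind.
transitivity (\esum_(b in [set: B]) \esum_(a in [set: A]) (p a * k a b * F b)).
  apply: eq_esum => b _; rewrite muleC -esumZl//; last first.
    by move=> a; exact: mule_ge0.
  by apply: eq_esum => a _; rewrite muleC.
rewrite exchange_esum; last by move=> a b; rewrite !mule_ge0.
apply: eq_esum => a _; rewrite -esumZl//; last by move=> b; exact: mule_ge0.
by apply: eq_esum => b _; rewrite muleA.
Qed.

Lemma bind_law (R : realType) (A B : choiceType) (p : law R A)
    (k : A -> law R B) :
  is_law p -> (forall a, is_law (k a)) -> is_law (bind p k).
Proof.
move=> pl kl; have [p0 p1] := pl; have k0 a b : 0 <= k a b by have [] := kl a.
split; first exact: bind_ge0.
have := @Ex_bind R A B p k (fun=> 1) p0 k0 (fun=> lee01).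
rewrite {1}/Ex; under eq_esum do rewrite mule1.
by move=> ->; under eq_Ex do rewrite Ex_cst//; exact: Ex_cst.
Qed.

Lemma Ex_lmap (R : realType) (A B : choiceType) (f : A -> B) (p : law R A)
    (F : B -> \bar R) :
  (forall a, 0 <= p a) -> (forall b, 0 <= F b) ->
  Ex (lmap f p) F = Ex p (fun a => F (f a)).
Proof.
move=> p0 F0; rewrite Ex_bind//; last by move=> a b; rewrite lee_fin.
by apply: eq_Ex => a; rewrite Ex_ret.
Qed.

Lemma lmap_law (R : realType) (A B : choiceType) (f : A -> B) (p : law R A) :
  is_law p -> is_law (lmap f p).
Proof. by move=> pl; apply: bind_law => // a; exact: ret_law. Qed.

Lemma Ex_coin (R : realType) (p : R) (F : bool -> \bar R) :
  (0 <= p <= 1)%R -> (forall b, 0 <= F b) ->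
  Ex (coin p) F = p%:E * F true + (1 - p)%R%:E * F false.
Proof.
move=> /andP[p0 p1] F0; rewrite /Ex esum_finType ?big_bool//.
by case; rewrite mule_ge0// lee_fin /= ?subr_ge0.
Qed.

Lemma coin_law (R : realType) (p : R) : (0 <= p <= 1)%R -> is_law (coin p).
Proof.
move=> p01; have c0 b : 0 <= coin p b by rewrite lee_fin bernoulli_pmf_ge0.
split=> //; rewrite esum_finType// big_bool /coin /= -EFinD.
by rewrite addrC subrK.
Qed.

Lemma unif_law (R : realType) (A : choiceType) (s : seq A) :
  s != [::] -> is_law (unif R s).
Proof.
move=> sn0; have sz : ((size s)%:R != 0 :> R)%R by rewrite pnatr_eq0 size_eq0.
split=> [a|]; first by rewrite lee_fin divr_ge0.
(* Counting list positions rather than values accounts for repetitions: after exchanging the sums,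
   each position contributes the inverse of the length. *)
transitivity (\esum_(a in [set: A])
    (\sum_(b <- s) ((b == a)%:R / (size s)%:R : R)%:E)%E).
  apply: eq_esum => a _; rewrite /unif sumEFin -mulr_suml -natr_sum.
  by rewrite -sum1_count big_mkcond.
rewrite esum_sum; last by move=> a b _ _; rewrite lee_fin divr_ge0.
transitivity ((\sum_(b <- s) ((size s)%:R^-1 : R)%:E)%E).
  apply: eq_bigr => b _; rewrite (esumT_single (t := b)).
  - by rewrite eqxx mul1r.
  - by rewrite lee_fin divr_ge0.
  - by move=> a ab; rewrite eq_sym (negPf ab) mul0r.
rewrite sumEFin big_const_seq count_predT iter_addr_0.
by rewrite -[X in X%:E]mulr_natr mulVf.
Qed.

Lemma esumT_inj (R : realType) (T T' : choiceType) (e : T -> T')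
    (a : T' -> \bar R) :
  injective e -> (forall j, ~ range e j -> a j = 0) ->
  \esum_(j in [set: T']) a j = \esum_(i in [set: T]) a (e i).
Proof.
move=> einj a0; rewrite -(esum_image setT e a) => [|i j _ _ /einj //].
rewrite [RHS]esum_mkcond; apply: eq_esum => j _.
by case: ifPn => //; rewrite notin_setE => /a0.
Qed.

(** * The geometric law and its tail *)

Lemma geom_ge0 (R : realType) (eps : R) :
  (0 < eps)%R -> (eps < 1)%R -> forall l, 0 <= geom eps l.
Proof.
move=> e0 e1 [|l]; rewrite lee_fin//.
by rewrite mulr_ge0 ?exprn_ge0 ?subr_ge0 ?ltW.
Qed.

Lemma geom_law (R : realType) (eps : R) :
  (0 < eps)%R -> (eps < 1)%R -> is_law (geom eps).
Proof.
move=> e0 e1; have g0 := geom_ge0 e0 e1; split=> //.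
rewrite (@esumT_inj _ _ _ succn); last 2 first.
- by move=> i j [].
- by case=> // j; case; exists j.
rewrite -nneseries_esumT//.
have q1 : (`|1 - eps| < 1)%R.
  by rewrite ger0_norm ?subr_ge0 ?ltW// ltrBlDr ltrDl.
have := cvg_geometric_series (a := eps) q1.
rewrite subKr mulfV ?gt_eqF// => cv.
apply/cvg_lim => //.
rewrite (_ : (fun _ => _) = EFin \o series (geometric eps (1 - eps)%R)).
  by apply: cvg_EFin; [exact: nearW|exact: cv].
by apply/funext => n /=; rewrite sumEFin.
Qed.

(** Memorylessness: shifted by [k], the geometric mass function is [(1 - eps) ^+ k] times itself, so
    lengths above [k] have total mass [(1 - eps) ^+ k]. *)
Lemma Ex_geom_tail (R : realType) (eps : R) (k : nat) (c : \bar R)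
    (F : nat -> \bar R) :
  (0 < eps)%R -> (eps < 1)%R -> 0 <= c -> (forall l, 0 <= F l) ->
  (forall l, (k < l)%N -> c <= F l) ->
  ((1 - eps) ^+ k)%:E * c <= Ex (geom eps) F.
Proof.
move=> e0 e1 c0 F0 cF; have g0 := geom_ge0 e0 e1.
have q0 : (0 <= 1 - eps)%R by rewrite subr_ge0 ltW.
pose G l := if (k < l)%N then c else 0.
have -> : ((1 - eps) ^+ k)%:E * c = Ex (geom eps) G.
  rewrite /Ex (@esumT_inj _ _ _ (addn k.+1)); last 2 first.
  - exact: addnI.
  - move=> j nj; rewrite /G; case: ltnP => [kj|_]; rewrite ?mule0//.
    by case: nj; exists (j - k.+1)%N => //; rewrite subnKC.
  transitivity (\esum_(j in [set: nat])
      ((((1 - eps) ^+ k)%:E * c) * geom eps j.+1)); last first.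
    apply: eq_esum => j _; rewrite /G leq_addr /geom addSn exprD mulrCA EFinM.
    by rewrite !EFinM -!muleA; congr (_ * _); rewrite muleC -muleA.
  rewrite esumZl//; last first.
    by rewrite mule_ge0// lee_fin exprn_ge0.
  rewrite (_ : esum _ _ = 1) ?mule1 1?muleC//.
  rewrite -(geom_law e0 e1).2 [RHS](@esumT_inj _ _ _ succn)//.
    by move=> i j [].
  by case=> // j; case; exists j.
apply: le_Ex => // l; rewrite /G; case: ltnP => // kl; exact: cF.
Qed.

(** * Joint laws of independent coordinates *)

Lemma prode_ge0 (R : realType) (I : Type) (r : seq I) (F : I -> \bar R) :
  (forall i, 0 <= F i) -> 0 <= \prod_(i <- r) F i.
Proof.
by move=> F0; elim/big_ind: _ => // x y; exact: mule_ge0.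
Qed.

(* Fixing [f] off [r] lets the coordinates be split off one at a time. *)
Lemma esum_prod_seq (R : realType) (I : finType) (A : choiceType) (a0 : A)
    (r : seq I) (F : I -> A -> \bar R) :
  (forall i a, 0 <= F i a) -> uniq r ->
  \esum_(f in [set f : {ffun I -> A} | forall i, i \notin r -> f i = a0])
     (\prod_(i <- r) F i (f i)) =
  \prod_(i <- r) \esum_(a in [set: A]) F i a.
Proof.
move=> F0; elim: r => [|i r IH] /=.
  move=> _; rewrite big_nil (_ : [set _ | _] = [set [ffun=> a0]]); last first.
    apply/seteqP; split=> [f fa|f -> i _]; last by rewrite ffunE.
    by apply/ffunP => i; rewrite ffunE fa.
  by rewrite esum_set1 big_nil//.
move=> /andP[ir ur]; rewrite big_cons -IH// muleC.
set S := [set f : {ffun I -> A} | forall j, j \notin r -> f j = a0].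
rewrite -esumZl; [|by apply: esum_ge0 => f _; exact: prode_ge0|exact: F0].
transitivity (\esum_(a in [set: A]) \esum_(f in S)
    (F i a * \prod_(j <- r) F j (f j))); last first.
  apply: eq_esum => a _; rewrite esumZl 1?muleC// => f; exact: prode_ge0.
rewrite esum_esum; last by move=> a f _ _; rewrite mule_ge0// prode_ge0.
rewrite (reindex_esum ([set: A] `*`` (fun=> S)) _ (fun x : A * {ffun I -> A} =>
  [ffun j => if j == i then x.1 else x.2 j])).
  apply: eq_esum => -[a f] _ /=; rewrite big_cons ffunE eqxx; congr (_ * _).
  apply: eq_big_seq => j jr; rewrite ffunE; case: eqP => // ji.
  by move: ir; rewrite -ji jr.
split=> /=.
- move=> [a f] [_ /= fS] j; rewrite inE negb_or ffunE => /andP[/negPf-> jr].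
  exact: fS.
- move=> [a f] [b g]; rewrite !inE => -[_ fS] [_ gS] /ffunP fg; congr pair.
    by have := fg i; rewrite !ffunE eqxx.
  apply/ffunP => j; have := fg j; rewrite !ffunE; case: eqP => // -> _.
  by rewrite fS// gS.
- move=> f fS; exists (f i, [ffun j => if j == i then a0 else f j]) => /=.
    split=> // j jr /=; rewrite ffunE; case: eqP => // /eqP ji.
    by apply: fS; rewrite inE negb_or ji.
  by apply/ffunP => j; rewrite !ffunE; case: eqP => // ->.
Qed.

Lemma esum_prod (R : realType) (I : finType) (A : choiceType) (a0 : A)
    (F : I -> A -> \bar R) : (forall i a, 0 <= F i a) ->
  \esum_(f in [set: {ffun I -> A}]) (\prod_(i : I) F i (f i)) =
  \prod_(i : I) \esum_(a in [set: A]) F i a.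
Proof.
move=> F0; rewrite -(esum_prod_seq a0)// ?index_enum_uniq//.
by congr esum; apply/seteqP; split=> // f _ i; rewrite mem_index_enum.
Qed.

Lemma indep_ge0 (R : realType) (I : finType) (A : choiceType)
    (p : I -> law R A) :
  (forall i, is_law (p i)) -> forall f, 0 <= indep p f.
Proof. by move=> pl f; apply: prode_ge0 => i; have [] := pl i. Qed.

Lemma indep_law (R : realType) (I : finType) (A : choiceType) (a0 : A)
    (p : I -> law R A) :
  (forall i, is_law (p i)) -> is_law (indep p).
Proof.
move=> pl; split; first exact: indep_ge0.
rewrite esum_prod//; last by move=> i a; have [] := pl i.
by rewrite big1// => i _; have [] := pl i.
Qed.

(** A factor 1 inserted at every coordinate other than [i] turns the integrand into a product; those
    coordinates then integrate to 1. *)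
Lemma Ex_indep_coord (R : realType) (I : finType) (A : choiceType)
    (a0 : A) (p : I -> law R A) (i : I) (F : A -> \bar R) :
  (forall i, is_law (p i)) -> (forall a, 0 <= F a) ->
  Ex (indep p) (fun f => F (f i)) = Ex (p i) F.
Proof.
move=> pl F0; have p0 j a : 0 <= p j a by have [] := pl j.
transitivity (\esum_(f in [set: {ffun I -> A}])
    (\prod_(j : I) (p j (f j) * (if j == i then F (f j) else 1)))).
  apply: eq_esum => f _; rewrite big_split/=; congr (_ * _).
  by rewrite -big_mkcond big_pred1_eq.
rewrite (@esum_prod R I A a0
  (fun j a => p j a * (if j == i then F a else 1))); last first.
  by move=> j a; rewrite mule_ge0//; case: ifP.
rewrite (bigD1 i)//= big1 ?mule1; last first.
  move=> j /negPf ->; under eq_esum do rewrite mule1.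
  by have [] := pl j.
by rewrite eqxx.
Qed.

(** * The value of a single walk *)

Lemma step_law (R : realType) (n : nat) (es : seq (edge n)) (s u : 'I_n) :
  is_law (step R es s u).
Proof.
rewrite /step; case: ifPn => [_|]; first exact: ret_law.
by rewrite /out_deg size_eq0 => ?; exact: unif_law.
Qed.

Lemma moves_law (R : realType) (n : nat) (es : seq (edge n)) (s u : 'I_n)
    (k : nat) : is_law (moves R es s u k).
Proof.
elim: k u => [|k IH] u /=; first exact: ret_law.
by apply: bind_law => [|v]; [exact: step_law|exact: lmap_law].
Qed.

Lemma fresh_walk_law (R : realType) (n : nat) (eps : R) (es : seq (edge n))
    (s : 'I_n) : (0 < eps)%R -> (eps < 1)%R -> is_law (fresh_walk eps es s).
Proof.
move=> e0 e1; apply: bind_law => [|l]; first exact: geom_law.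
by apply: lmap_law; exact: moves_law.
Qed.

Lemma invn_itv01 (R : realType) (d : nat) :
  (0 <= (d%:R^-1 : R) <= 1)%R.
Proof.
(* At [d = 0] the inverse is 0 by convention, so the bounds still hold. *)
rewrite invr_ge0 ler0n /=; case: d => [|d]; first by rewrite invr0.
by rewrite invf_le1 ?ltr0n// ler1n.
Qed.

Lemma update_walk_law (R : realType) (n : nat) (es : seq (edge n))
    (e : edge n) (s : 'I_n) (w : seq 'I_n) :
  is_law (update_walk R es e s w).
Proof.
case: e => u v; rewrite /update_walk; case: ifP => _; last exact: ret_law.
apply: bind_law => [|[]]; first by apply: coin_law; exact: invn_itv01.
  by apply: lmap_law; exact: moves_law.
exact: ret_law.
Qed.

(** The law [moves] charges only sequences of length [k], so a bound valid on these survives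
    averaging, wherever the walk goes. *)
Lemma Ex_moves_ge (R : realType) (n : nat) (es : seq (edge n)) (s u : 'I_n)
    (k : nat) (c : R) (F : seq 'I_n -> \bar R) :
  (0 <= c)%R -> (forall t, 0 <= F t) -> (forall t, size t = k -> c%:E <= F t) ->
  c%:E <= Ex (moves R es s u k) F.
Proof.
move=> c0; elim: k u F => [|k IH] u F F0 cF /=; first by rewrite Ex_ret// cF.
rewrite Ex_bind//; [|exact: (step_law _ _ _ _).1|]; last first.
  by move=> v; exact: (lmap_law _ (moves_law _ _ _ _ _)).1.
rewrite -(@Ex_cst _ _ (step R es s u) c%:E)//; last exact: step_law.
apply: le_Ex => [|v]; first exact: (step_law _ _ _ _).1.
rewrite Ex_lmap//; last exact: (moves_law _ _ _ _ _).1.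
by apply: IH => // t tk; apply: cF; rewrite /= tk.
Qed.

(** Conditioning on the coin: [c1] serves the regenerated walk, [c2] the untouched one. The new
    remainder enters only through its length, chosen so that the total length is preserved. *)
Lemma Ex_update_ge (R : realType) (n : nat) (es : seq (edge n))
    (u v s : 'I_n) (w : seq 'I_n) (c1 c2 : R)
    (F : seq 'I_n * bool -> \bar R) :
  let i := index u w in let q := ((out_deg es u)%:R^-1 : R)%R in
  (i.+1 < size w)%N -> (0 <= c1)%R -> (0 <= c2)%R -> (forall y, 0 <= F y) ->
  (forall t, size t = (size w - i.+2)%N ->
     c1%:E <= F (take i.+1 w ++ v :: t, true)) ->
  c2%:E <= F (w, false) ->
  (q * c1 + (1 - q) * c2)%:E <= Ex (update_walk R es (u, v) s w) F.
Proof.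
move=> i q iw c10 c20 F0 F1 F2; rewrite /update_walk -/i iw -/q.
have /andP[q0 q1] : (0 <= q <= 1)%R by exact: invn_itv01.
have kl (b : bool) : is_law
    (if b then lmap (fun t => (take i.+1 w ++ v :: t, true))
                 (moves R es s v (size w - i.+2))
     else ret R (w, false)).
  by case: b; [apply: lmap_law; exact: moves_law|exact: ret_law].
rewrite Ex_bind//; [|by apply: (coin_law _).1; rewrite q0|]; last first.
  by move=> b y; exact: (kl b).1.
rewrite Ex_coin ?q0//; last by move=> b; apply: Ex_ge0 => //; exact: (kl b).1.
rewrite EFinD !EFinM Ex_ret//; apply: leeD; apply: lee_wpmul2l => //.
- rewrite Ex_lmap//; last exact: (moves_law _ _ _ _ _).1.
  exact: Ex_moves_ge.
- by rewrite lee_fin subr_ge0.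
Qed.

(* The expected number of regenerations of the walk [w] caused by the arrivals
   [fut], plus the expectation of [f] at the resulting walk. *)
Fixpoint walk_value (R : realType) (n : nat) (past fut : seq (edge n))
    (s : 'I_n) (f : seq 'I_n -> \bar R) (w : seq 'I_n) {struct fut} : \bar R :=
  if fut is e :: fut' then
    Ex (update_walk R (rcons past e) e s w)
       (fun y => (y.2%:R : R)%:E + walk_value (rcons past e) fut' s f y.1)
  else f w.

Lemma walk_value_ge0 (R : realType) (n : nat) (past fut : seq (edge n))
    (s : 'I_n) (f : seq 'I_n -> \bar R) (w : seq 'I_n) :
  (forall w, 0 <= f w) -> 0 <= walk_value past fut s f w.
Proof.
move=> f0; elim: fut past w => [|e fut IH] past w //=.
apply: Ex_ge0 => [|y]; first exact: (update_walk_law _ _ _ _ _).1.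
by rewrite adde_ge0// lee_fin.
Qed.

(** The purpose of the terminal function [f]: the value of the later arrivals becomes the terminal
    function of the earlier ones. *)
Lemma walk_value_cat (R : realType) (n : nat) (past fut1 fut2 : seq (edge n))
    (s : 'I_n) (f : seq 'I_n -> \bar R) (w : seq 'I_n) :
  walk_value past (fut1 ++ fut2) s f w =
  walk_value past fut1 s (walk_value (past ++ fut1) fut2 s f) w.
Proof.
elim: fut1 past w => [|e fut IH] past w /=; first by rewrite cats0.
by apply: eq_Ex => y; rewrite IH cat_rcons.
Qed.

Lemma run_ge0 (R : realType) (n Rw : nat) (past fut : seq (edge n))
    (x : store n Rw * nat) : forall y, 0 <= run R past fut x y.
Proof.
elim: fut past x => [|e fut IH] past x /=; first exact: (ret_law _ _).1.
apply: bind_ge0 => // y; apply: bind_ge0 => [|z].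
  by apply: indep_ge0 => sj; exact: update_walk_law.
exact: (ret_law _ _).1.
Qed.

(** By linearity of expectation the count splits over the stored walks, and the update of each walk
    depends on that walk alone; hence a sum of single-walk values. *)
Lemma Ex_run (R : realType) (n Rw : nat) (past fut : seq (edge n))
    (x : store n Rw * nat) :
  Ex (run R past fut x) (fun y => (y.2%:R : R)%:E) =
  (x.2%:R : R)%:E +
  \sum_(sj : 'I_n * 'I_Rw) walk_value past fut sj.1 (fun=> 0) (x.1 sj).
Proof.
elim: fut past x => [|e fut IH] past x /=.
  by rewrite Ex_ret// big1 ?adde0.
pose p (sj : 'I_n * 'I_Rw) := update_walk R (rcons past e) e sj.1 (x.1 sj).
have pl sj : is_law (p sj) by exact: update_walk_law.
have i0 := indep_ge0 pl.
have v0 sj w : 0 <= walk_value (rcons past e) fut sj (fun=> 0 : \bar R) w.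
  exact: walk_value_ge0.
rewrite Ex_bind//; last by move=> y; exact: run_ge0.
  under eq_Ex do rewrite IH.
  rewrite Ex_lmap//=; last by move=> y; rewrite adde_ge0 ?lee_fin ?sume_ge0.
  (* The number of flagged walks is rewritten as a sum of indicators and merged, walk by walk, with
     the values of the later arrivals. *)
  transitivity (Ex (indep p) (fun y => (x.2%:R : R)%:E +
      \sum_sj (((y sj).2%:R : R)%:E +
               walk_value (rcons past e) fut sj.1 (fun=> 0) (y sj).1))).
    apply: eq_Ex => y; rewrite natrD EFinD -addeA big_split/=; congr (_ + (_ + _)).
      rewrite sumEFin -natr_sum -sum1_card big_mkcond/=.
      by congr (_%:R)%:E; apply: eq_bigr => sj _; rewrite inE; case: (y sj).2.
    by apply: eq_bigr => sj _; rewrite ffunE.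
  rewrite Ex_add//; last first.
    by move=> y; apply: sume_ge0 => sj _; rewrite adde_ge0// lee_fin.
  rewrite Ex_cst ?lee_fin//; last exact: (indep_law ([::], false)).
  congr (_ + _); rewrite Ex_sum//; last first.
    by move=> sj y; rewrite adde_ge0// lee_fin.
  apply: eq_bigr => sj _.
  rewrite (@Ex_indep_coord _ _ _ ([::], false) _ sj (fun z => (z.2%:R : R)%:E +
    walk_value (rcons past e) fut sj.1 (fun=> 0) z.1))//.
  by move=> z; rewrite adde_ge0// lee_fin.
by apply: bind_ge0 => // y; exact: (ret_law _ _).1.
Qed.

Lemma expected_updatesE (R : realType) (n Rw : nat) (eps : R)
    (order : seq (edge n)) : (0 < eps)%R -> (eps < 1)%R ->
  expected_updates Rw eps order =
  \sum_(sj : 'I_n * 'I_Rw)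
    Ex (fresh_walk eps [::] sj.1) (walk_value [::] order sj.1 (fun=> 0)).
Proof.
move=> e0 e1.
have fl (sj : 'I_n * 'I_Rw) : is_law (fresh_walk eps [::] sj.1).
  exact: fresh_walk_law.
transitivity (Ex (bind (@init_store R n Rw eps)
    (fun st => run R [::] order (st, 0%N))) (fun y => (y.2%:R : R)%:E)) => //.
rewrite Ex_bind//; last 2 first.
- exact: indep_ge0.
- by move=> st; exact: run_ge0.
under eq_Ex do rewrite Ex_run add0e.
rewrite Ex_sum; last 2 first.
- exact: indep_ge0.
- by move=> sj st; exact: walk_value_ge0.
apply: eq_bigr => sj _.
rewrite (@Ex_indep_coord _ _ _ [::] _ sj
  (walk_value [::] order sj.1 (fun=> 0 : \bar R)))// => w.
exact: walk_value_ge0.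
Qed.

(** * Walks with a prescribed beginning *)

(** Since [u] is not in [p], its first visit lies beyond [p], and the cut after it leaves the prefix
    [p] intact. *)
Lemma Ex_update_keep (R : realType) (n : nat) (es : seq (edge n))
    (u v s : 'I_n) (p w : seq 'I_n) (c : R) (F : seq 'I_n * bool -> \bar R) :
  (0 <= c)%R -> (forall y, 0 <= F y) -> prefix p w -> u \notin p ->
  (forall w' b, prefix p w' -> size w' = size w -> c%:E <= F (w', b)) ->
  c%:E <= Ex (update_walk R es (u, v) s w) F.
Proof.
move=> c0 F0 pw up cF; have [iw|iw] := ltnP (index u w).+1 (size w); last first.
  by rewrite /update_walk ltnNge iw Ex_ret// cF.
set q := ((out_deg es u)%:R^-1 : R)%R.
rewrite (_ : c = q * c + (1 - q) * c)%R; last by ring.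
apply: Ex_update_ge => // [t st|]; last exact: cF.
apply: cF; last by rewrite size_cat /= st size_takel; lia.
have /prefixP[w' ->] := pw; rewrite index_cat (negPf up) -addnS takeD.
by rewrite take_size_cat// -catA prefix_prefix.
Qed.

(** These arrivals may regenerate the walk, but only beyond [p] and with its length preserved; their
    own counts are bounded below by 0. *)
Lemma walk_value_keep (R : realType) (n : nat) (past fut : seq (edge n))
    (s : 'I_n) (p w : seq 'I_n) (c : R) (f : seq 'I_n -> \bar R) :
  (0 <= c)%R -> (forall w, 0 <= f w) -> prefix p w ->
  all (fun e => e.1 \notin p) fut ->
  (forall w', prefix p w' -> size w' = size w -> c%:E <= f w') ->
  c%:E <= walk_value past fut s f w.
Proof.
move=> c0 f0; elim: fut past w => [|[u v] fut IH] past w pw /=.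
  by move=> _; apply.
move=> /andP[up fp] cf; apply: Ex_update_keep pw up _ => //.
  by move=> y; rewrite adde_ge0 ?lee_fin// walk_value_ge0.
move=> w' b pw' sw' /=; rewrite -[leLHS]add0e; apply: leeD.
  by rewrite lee_fin.
by apply: IH => // w'' pw'' sw''; apply: cf => //; rewrite sw''.
Qed.

(** The first visit to [u] is right after [p], and the length condition ensures a part after it.
    With probability [1/d] the arrival counts 1 and extends the known prefix by [v]. *)
Lemma walk_value_cons_ge (R : realType) (n : nat) (past fut : seq (edge n))
    (u v s : 'I_n) (p w : seq 'I_n) (d : nat) (c1 c2 : R)
    (f : seq 'I_n -> \bar R) :
  out_deg (rcons past (u, v)) u = d ->
  (0 <= c1)%R -> (0 <= c2)%R -> (forall w, 0 <= f w) ->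
  u \notin p -> prefix (rcons p u) w -> ((size p).+1 < size w)%N ->
  (forall w', prefix (rcons (rcons p u) v) w' -> size w' = size w ->
     c1%:E <= walk_value (rcons past (u, v)) fut s f w') ->
  c2%:E <= walk_value (rcons past (u, v)) fut s f w ->
  (d%:R^-1 * (1 + c1) + (1 - d%:R^-1) * c2)%:E <=
  walk_value past ((u, v) :: fut) s f w.
Proof.
move=> <- c10 c20 f0 up pw lw H1 H2.
have iw : index u w = size p.
  have /prefixP[w' ->] := pw.
  by rewrite -cats1 -catA index_cat (negPf up) /= eqxx addn0.
apply: Ex_update_ge; rewrite ?iw//.
- by rewrite addr_ge0.
- by move=> y; rewrite adde_ge0 ?lee_fin// walk_value_ge0.
- move=> t st /=; rewrite EFinD leeD2l//; have /prefixP[w' ew] := pw.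
  apply: H1; last by rewrite size_cat /= st size_takel; lia.
  rewrite ew -(size_rcons p u) take_size_cat// -[X in prefix X _]cats1.
  by rewrite -[v :: t]cat1s catA prefix_prefix.
- by rewrite /= add0e.
Qed.

Lemma out_degE (n : nat) (es : seq (edge n)) (u : 'I_n) :
  out_deg es u = count (fun e => e.1 == u) es.
Proof. by rewrite /out_deg /out_nbrs size_map size_filter. Qed.

(** * The binary tree *)

(* The complete binary tree of depth [k] whose nodes are numbered in preorder
   from [a]; an edge arrives right before the whole subtree below it. *)
Fixpoint tree_order (n a k : nat) : seq (edge n.+1) :=
  if k is k'.+1 then
    (inord a, inord a.+1) :: tree_order n a.+1 k' ++
    (inord a, inord (a + 2 ^ k)) :: tree_order n (a + 2 ^ k) k'
  else [::].

(* The nodes of that tree are [a], ..., [a + 2 ^ k.+1 - 2]. *)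
Definition in_tree (a k x : nat) : bool := (a <= x)%N && (x.+1 < a + 2 ^ k.+1)%N.

(** In preorder the two subtrees occupy consecutive intervals after the root, and every child
    exceeds its parent. The hypothesis keeps all numbers at most [n], where [inord] is faithful. *)
Lemma tree_order_bounds (n a k : nat) (e : edge n.+1) :
  (a + 2 ^ k.+1 <= n.+2)%N -> e \in tree_order n a k ->
  [/\ in_tree a k e.1, in_tree a k e.2 & (e.1 < e.2)%N].
Proof.
rewrite /in_tree; elim: k a => [//|k IH] a an /=.
have k0 : (0 < 2 ^ k)%N by rewrite expn_gt0.
rewrite inE mem_cat inE; move: (IH a.+1) (IH (a + 2 ^ k.+1)%N) an.
rewrite !(expnS 2); set m := (2 ^ k)%N in k0 * => IH1 IH2 an.
move=> /or4P[/eqP->|/IH1-/(_ ltac:(lia))[]|/eqP->|/IH2-/(_ ltac:(lia))[]] /=.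
- by rewrite !inordK; [split; lia|lia..].
- by move=> *; split; lia.
- by rewrite !inordK; [split; lia|lia..].
- by move=> *; split; lia.
Qed.

Lemma size_tree_order (n a k : nat) : (size (tree_order n a k)).+2 = (2 ^ k.+1)%N.
Proof.
elim: k a => [//|k IH] a /=; rewrite size_cat /= [RHS]expnS.
by have := IH a.+1; have := IH (a + 2 ^ k.+1)%N; lia.
Qed.

(** A node has at most one parent; this is what makes the tree edges distinct. *)
Lemma tree_order_uniq_targets (n a k : nat) :
  (a + 2 ^ k.+1 <= n.+2)%N ->
  uniq [seq e.2 | e <- tree_order n a k].
Proof.
elim: k a => [//|k IH] a an.
have k0 : (0 < 2 ^ k)%N by rewrite expn_gt0.
have b1 := @tree_order_bounds n a.+1 k; have b2 := @tree_order_bounds n (a + 2 ^ k.+1) k.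
have := IH a.+1; have := IH (a + 2 ^ k.+1)%N.
move: an b1 b2; rewrite /= /in_tree !(expnS 2); set m := (2 ^ k)%N in k0 *.
move=> an b1 b2 u2 u1; rewrite map_cat /= mem_cat inE cat_uniq /= u1 ?u2; [|lia..].
rewrite andbT; apply/and4P; split=> //.
- rewrite !negb_or; apply/and3P; split.
  + apply/mapP => -[e /b1-/(_ ltac:(lia))[h1 h2 h3] /(congr1 val)/=].
    by rewrite inordK; lia.
  + by apply/eqP => /(congr1 val)/=; rewrite !inordK; lia.
  + apply/mapP => -[e /b2-/(_ ltac:(lia))[h1 h2 h3] /(congr1 val)/=].
    by rewrite inordK; lia.
- rewrite negb_or; apply/andP; split.
  + apply/mapP => -[e /b1-/(_ ltac:(lia))[h1 h2 h3] /(congr1 val)/=].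
    by rewrite inordK; lia.
  + apply/hasPn => x /mapP[e /b2-/(_ ltac:(lia))[h1 h2 h3] ->].
    apply/mapP => -[e' /b1-/(_ ltac:(lia))[h1' h2' h3'] /(congr1 val)/=].
    by lia.
- apply/mapP => -[e /b2-/(_ ltac:(lia))[h1 h2 h3] /(congr1 val)/=].
  by rewrite inordK; lia.
Qed.

(** Induction on the depth, for all [c] and [f] at once: the terminal function of the left subtree
    is the value of everything that follows it. As [past] has no edge out of a tree node, the
    out-degrees met are exactly 1 and 2. The length bound leaves room for a full descent. *)
Lemma tree_value_ge (R : realType) (n a k : nat) (past : seq (edge n.+1))
    (s : 'I_n.+1) (p w : seq 'I_n.+1) (c : R) (f : seq 'I_n.+1 -> \bar R) :
  (a + 2 ^ k.+1 <= n.+2)%N ->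
  (forall e, e \in past -> ~~ in_tree a k e.1) ->
  (forall x, x \in p -> ~~ in_tree a k x) ->
  (0 <= c)%R -> (forall w, 0 <= f w) ->
  (forall w', prefix (rcons p (inord a)) w' -> size w' = size w ->
     c%:E <= f w') ->
  prefix (rcons p (inord a)) w -> ((size p).+1 + k <= size w)%N ->
  (c + (3 / 2) ^+ k - 1)%:E <= walk_value past (tree_order n a k) s f w.
Proof.
move=> + + + c0 f0.
elim: k a past p w c f c0 f0 => [|k IH] a past p w c f c0 f0 an pastP pP cf pw lw.
  by rewrite /= expr0 addrK; exact: cf.
have k0 : (0 < 2 ^ k)%N by rewrite expn_gt0.
have h0 : (1 <= (3 / 2) ^+ k :> R)%R.
  by apply: exprn_ege1; rewrite ler_pdivlMr ?ltr0n// mul1r ler_nat.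
set h := ((3 / 2) ^+ k : R)%R in h0 *.
have a1n : (a.+1 + 2 ^ k.+1 <= n.+2)%N by move: an; rewrite !(expnS 2); lia.
have a2n : (a + 2 ^ k.+1 + 2 ^ k.+1 <= n.+2)%N by move: an; rewrite !(expnS 2); lia.
have b1 e := @tree_order_bounds n a.+1 k e a1n.
have b2 e := @tree_order_bounds n (a + 2 ^ k.+1) k e a2n.
pose u : 'I_n.+1 := inord a; pose v1 : 'I_n.+1 := inord a.+1.
pose v2 : 'I_n.+1 := inord (a + 2 ^ k.+1).
have uE : u = a :> nat by rewrite inordK; move: an; rewrite !(expnS 2); lia.
have up : u \notin p.
  apply/negP => /pP; rewrite /in_tree uE !(expnS 2); lia.
have past0 : count (fun e => e.1 == u) past = 0%N.
  apply/eqP; rewrite eqn0Ngt -has_count; apply/hasPn => e /pastP.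
  by apply: contra => /eqP ->; rewrite /in_tree uE !(expnS 2); lia.
have tree0 : count (fun e => e.1 == u) (tree_order n a.+1 k) = 0%N.
  apply/eqP; rewrite eqn0Ngt -has_count; apply/hasPn => e /b1[h1 _ _].
  by apply/eqP => eu; move: h1; rewrite eu /in_tree uE; lia.
pose past1 := rcons past (u, v1) ++ tree_order n a.+1 k.
(* From the second edge on, whatever follows [u]: with probability 1/2 the walk gains 1 and then
   [c + h - 1] from the right subtree; otherwise that subtree leaves [rcons p u] alone and [c]
   remains. The average is [c + h / 2]. *)
have second w' : prefix (rcons p u) w' -> size w' = size w ->
    (c + h / 2)%:E <=
    walk_value past1 ((u, v2) :: tree_order n (a + 2 ^ k.+1) k) s f w'.
  move=> pw' sw'; have d2 : out_deg (rcons past1 (u, v2)) u = 2%N.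
    by rewrite out_degE -cats1 !count_cat -cats1 count_cat past0 tree0 /= eqxx.
  rewrite (_ : c + h / 2 = 2%:R^-1 * (1 + (c + h - 1)) + (1 - 2%:R^-1) * c)%R; last by field.
  apply: (walk_value_cons_ge d2 _ _ _ up pw') => //.
  - lra.
  - by rewrite sw' (leq_trans _ lw)//; lia.
  - move=> w'' pw'' sw''; apply: (IH _ _ _ _ _ _ _ _ _ _ _ _ pw'') => //.
    + move=> e; rewrite mem_rcons inE mem_cat mem_rcons inE -orbA.
      move=> /or4P[/eqP->|/eqP->|/pastP|/b1[+ _ _]]; rewrite /in_tree /= ?uE !(expnS 2); lia.
    + move=> x; rewrite mem_rcons inE => /orP[/eqP->|/pP];
        rewrite /in_tree ?uE !(expnS 2); lia.
    + move=> w3 pw3 sw3; apply: cf; last by rewrite sw3 sw''.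
      exact: prefix_trans (prefix_rcons _ _) pw3.
    + by rewrite size_rcons sw'' sw' addSnnS.
  - apply: (walk_value_keep _ _ c0 f0 pw') => // [|w'' pw'' sw''].
      apply/allP => -[x y] /b2[/= h1 _ _]; rewrite mem_rcons inE negb_or.
      apply/andP; split.
        by apply/eqP => xu; move: h1; rewrite xu /in_tree uE; lia.
      by apply/negP => /pP; move: h1; rewrite /in_tree !(expnS 2); lia.
    by apply: cf; rewrite // sw''.
have d1 : out_deg (rcons past (u, v1)) u = 1%N.
  by rewrite out_degE -cats1 count_cat past0 /= eqxx.
(* The first edge regenerates surely, and the left subtree is entered with terminal bound
   [c + h / 2]. The total, [c + 3 / 2 * h], exceeds the claim by 1. *)
apply: (@le_trans _ _ (1%:R^-1 * (1 + (c + h / 2 + h - 1)) + (1 - 1%:R^-1) * 0)%:E).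
  by rewrite lee_fin exprS -/h invr1; lra.
apply: (walk_value_cons_ge d1 _ _ _ up pw) => //.
- lra.
- by rewrite (leq_trans _ lw)//; lia.
- move=> w' pw' sw'; rewrite walk_value_cat; apply: (IH _ _ _ _ _ _ _ _ _ _ _ _ pw') => //.
  + lra.
  + by move=> w''; exact: walk_value_ge0.
  + move=> e; rewrite mem_rcons inE => /orP[/eqP->|/pastP]; rewrite /in_tree /= ?uE !(expnS 2); lia.
  + move=> x; rewrite mem_rcons inE => /orP[/eqP->|/pP]; rewrite /in_tree /= ?uE !(expnS 2); lia.
  + move=> w'' pw'' sw''; apply: second; last by rewrite sw'' sw'.
    exact: prefix_trans (prefix_rcons _ _) pw''.
  + by rewrite size_rcons sw' addSnnS.
- exact: walk_value_ge0.
Qed.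

(** * The lower bound *)

(** The common target 0 is to be the root of the tree, and [b] the first number after the tree
    nodes. *)
Definition star_order (n b M : nat) : seq (edge n.+1) :=
  [seq (inord i, inord 0) | i <- iota b M].

Lemma star_order_bounds (n b M : nat) (e : edge n.+1) :
  (b + M <= n.+1)%N -> e \in star_order n b M ->
  (b <= e.1 < b + M)%N /\ e.2 = 0%N :> nat.
Proof.
move=> bM /mapP[i]; rewrite mem_iota => /andP[bi ib] -> /=.
by rewrite !inordK; [split=> //; lia|lia..].
Qed.

Lemma star_order_uniq (n b M : nat) :
  (b + M <= n.+1)%N -> uniq (star_order n b M).
Proof.
move=> bM; rewrite map_inj_in_uniq ?iota_uniq// => i j.
rewrite !mem_iota => ib jb [] /(congr1 (@nat_of_ord _)).
by rewrite !inordK//; lia.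
Qed.

(** Star edges end at 0, whereas the target of a tree edge exceeds its source and so is positive;
    hence no edge is shared. *)
Lemma star_tree_simple (n k M : nat) : ((2 ^ k.+1).-1 + M = n.+1)%N ->
  simple_digraph (star_order n (2 ^ k.+1).-1 M ++ tree_order n 0 k).
Proof.
move=> nE; have k0 : (0 < 2 ^ k)%N by rewrite expn_gt0.
have sb e := @star_order_bounds n (2 ^ k.+1).-1 M e.
have kn : (0 + 2 ^ k.+1 <= n.+2)%N by lia.
have tb e := @tree_order_bounds n 0 k e kn.
apply/andP; split.
  rewrite cat_uniq star_order_uniq ?nE//= (map_uniq (tree_order_uniq_targets kn)).
  rewrite andbT; apply/hasPn => e /tb[_ _ e12]; apply/negP => /sb-/(_ ltac:(lia))[_].
  by move=> e2; move: e12; rewrite e2.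
rewrite all_cat; apply/andP; split; apply/allP => -[x y].
  move=> /sb-/(_ ltac:(lia))/=[xb y0]; apply/eqP => xy; move: xb.
  by rewrite xy y0 expnS; lia.
by move=> /tb[_ _ /= xy]; apply/eqP => xE; move: xy; rewrite xE ltnn.
Qed.

(** The edge from [s] is the only one leaving [s], so it surely sends the walk to the root. This
    regeneration makes up for the [- 1] in [tree_value_ge]. The other star edges start off the
    prefix. *)
Lemma star_walk_value_ge (R : realType) (n k M i : nat) (w : seq 'I_n.+1) :
  let b := (2 ^ k.+1).-1 in let s : 'I_n.+1 := inord i in
  (b + M = n.+1)%N -> (b <= i < b + M)%N ->
  prefix [:: s] w -> (k.+1 < size w)%N ->
  ((3 / 2) ^+ k)%:E <=
  walk_value [::] (star_order n b M ++ tree_order n 0 k) s (fun=> 0 : \bar R) w.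
Proof.
move=> b s nE /andP[bi ib] pw lw; have k0 : (0 < 2 ^ k)%N by rewrite expn_gt0.
have kn : (0 + 2 ^ k.+1 <= n.+2)%N by rewrite /b in nE; lia.
have h0 : (1 <= (3 / 2) ^+ k :> R)%R.
  by apply: exprn_ege1; rewrite ler_pdivlMr ?ltr0n// mul1r ler_nat.
set h := ((3 / 2) ^+ k : R)%R in h0 *.
have b0 : (0 < b)%N by rewrite /b expnS; lia.
have sE : s = i :> nat by rewrite inordK//; lia.
pose r : 'I_n.+1 := inord 0.
have rE : r = 0%N :> nat by rewrite inordK.
pose pre := star_order n b (i - b).
pose post := star_order n i.+1 (b + M - i.+1).
have -> : star_order n b M = pre ++ (s, r) :: post.
  rewrite /star_order -[(s, r) :: _]map_cons -map_cat; congr map.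
  rewrite -[_ :: _]/(iota i (b + M - i.+1).+1) -[in iota i _](subnKC bi) -iotaD.
  by congr iota; lia.
have preP e : e \in pre -> (b <= e.1 < i)%N.
  by move=> /star_order_bounds-/(_ ltac:(lia))[+ _]; rewrite subnKC.
have postP e : e \in post -> (i < e.1)%N.
  by move=> /star_order_bounds-/(_ ltac:(lia))[/andP[]].
rewrite -catA walk_value_cat; have hp1 : (0 <= h - 1)%R by rewrite subr_ge0.
have hp := le_trans ler01 h0.
have v0 (fut : seq (edge n.+1)) past (w0 : seq 'I_n.+1) :
    0 <= walk_value past fut s (fun=> 0 : \bar R) w0 by exact: walk_value_ge0.
apply: (walk_value_keep _ _ hp _ pw) => // [|w1 pw1 sw1].
  apply/allP => -[x y] /preP /= xP; rewrite inE; apply/eqP => xs.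
  by move: xP; rewrite xs sE; lia.
have d1 : out_deg (rcons pre (s, r)) s = 1%N.
  rewrite out_degE -cats1 count_cat /= eqxx (_ : count _ _ = 0%N)//.
  apply/eqP; rewrite eqn0Ngt -has_count; apply/hasPn => -[x y] /preP /= xP.
  by apply/eqP => xs; move: xP; rewrite xs sE; lia.
rewrite (_ : h = 1%:R^-1 * (1 + (h - 1)) + (1 - 1%:R^-1) * 0)%R; last first.
  by rewrite invr1; ring.
apply: (@walk_value_cons_ge _ _ _ _ _ _ _ [::] _ _ _ _ _ d1) => //.
- by rewrite sw1 /=; apply: leq_ltn_trans lw.
- move=> w2 pw2 sw2; rewrite walk_value_cat.
  apply: (walk_value_keep _ _ hp1 _ pw2) => // [|w3 pw3 sw3].
    apply/allP => -[x y] /postP /= xP; rewrite !inE negb_or.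
    by apply/andP; split; apply/eqP => xs; move: xP; rewrite xs ?sE ?rE; lia.
  rewrite -[h]add0r; apply: (@tree_value_ge _ _ _ _ _ _ [:: s]) => //.
  + move=> e; rewrite mem_cat mem_rcons inE /in_tree add0n.
    case: e => x y; case/orP => [/orP[/eqP[-> _]|/preP]|/postP] /=; rewrite ?sE /b in bi *; lia.
  + by move=> x; rewrite inE => /eqP ->; rewrite /in_tree sE add0n /b in bi *; lia.
  + by rewrite sw3 sw2 sw1.
Qed.

(** Only the first node and the length of the initial walk matter; at least [k + 2] visited nodes
    have probability [(1 - eps) ^+ k.+1]. *)
Lemma fresh_walk_value_ge (R : realType) (eps : R) (n k M i : nat) :
  let b := (2 ^ k.+1).-1 in let s : 'I_n.+1 := inord i in
  (0 < eps)%R -> (eps < 1)%R -> (b + M = n.+1)%N -> (b <= i < b + M)%N ->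
  ((1 - eps) ^+ k.+1 * (3 / 2) ^+ k)%:E <=
  Ex (fresh_walk eps [::] s)
     (walk_value [::] (star_order n b M ++ tree_order n 0 k) s
        (fun=> 0 : \bar R)).
Proof.
move=> b s e0 e1 nE ib; have h0 : (0 <= (3 / 2) ^+ k :> R)%R.
  by rewrite exprn_ge0// divr_ge0.
have v0 (fut : seq (edge n.+1)) (w : seq 'I_n.+1) :
    0 <= walk_value [::] fut s (fun=> 0 : \bar R) w by exact: walk_value_ge0.
have ml l := moves_law R [::] s s l.
rewrite Ex_bind//; [|exact: geom_ge0|]; last first.
  by move=> l; exact: (lmap_law _ (ml _)).1.
rewrite EFinM; apply: Ex_geom_tail => //.
  by move=> l; apply: Ex_ge0 => //; exact: (lmap_law _ (ml _)).1.
move=> l kl; rewrite Ex_lmap//; last exact: (ml _).1.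
apply: Ex_moves_ge => // t tl; apply: star_walk_value_ge => //.
  by rewrite /= eqxx prefix0s.
by rewrite /= tl prednK// (leq_ltn_trans _ kl).
Qed.

Lemma powR2_log2 (R : realType) (x : R) (k : nat) :
  (0 < x)%R -> ((2 ^ k)%:R `^ log2 x = x ^+ k)%R.
Proof.
move=> x0; have l2 : (0 < ln 2 :> R)%R by rewrite ln_gt0// ltr1n.
rewrite natrX -powR_mulrn// -powRrM mulrC powRrM powR_mulrn ?powR_ge0//.
congr (_ ^+ _)%R; rewrite /powR pnatr_eq0 /= /log2 divfK ?gt_eqF//.
by rewrite lnK.
Qed.

Lemma expected_updates_star_tree_ge (R : realType) (eps : R) (n k M Rw : nat) :
  let b := (2 ^ k.+1).-1 in
  (0 < eps)%R -> (eps < 1)%R -> (b + M = n.+1)%N ->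
  (M%:R * Rw%:R * ((1 - eps) ^+ k.+1 * (3 / 2) ^+ k))%:E <=
  expected_updates Rw eps (star_order n b M ++ tree_order n 0 k).
Proof.
move=> b e0 e1 nE; rewrite expected_updatesE//.
set B := ((1 - eps) ^+ k.+1 * (3 / 2) ^+ k)%R.
(* Only walks started at star leaves are credited; those started at tree nodes get the bound 0. *)
rewrite (_ : M%:R * Rw%:R * B = \sum_(sj : 'I_n.+1 * 'I_Rw)
    (if (b <= sj.1)%N then B else 0))%R; last first.
  rewrite -(pair_bigA _ (fun (s : 'I_n.+1) (_ : 'I_Rw) =>
    if (b <= s)%N then B else 0)%R) /=.
  rewrite (eq_bigr (fun s : 'I_n.+1 => if (b <= s)%N then B *+ Rw else 0)%R); last first.
    by move=> s _; rewrite big_const_ord iter_addr_0; case: ifP; rewrite ?mul0rn.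
  rewrite -big_mkcond -(big_geq_mkord _ _ xpredT (fun=> B *+ Rw)%R).
  by rewrite sumr_const_nat -nE addKn -mulrnA -[RHS]mulr_natr natrM; ring.
rewrite -sumEFin; apply: lee_sum => -[s j] _ /=; case: ifPn => [bs|_].
  rewrite -(inord_val s); apply: fresh_walk_value_ge => //.
  by rewrite bs nE ltn_ord.
apply: Ex_ge0 => [|w]; first exact: (fresh_walk_law _ _ e0 e1).1.
exact: walk_value_ge0.
Qed.

Local Close Scope ereal_scope.
Local Close Scope classical_set_scope.

Theorem theorem1 (R : realType) (eps : R) (eps_gt0 : 0 < eps)
    (eps_lt : eps < 1 / 3) :
  exists2 c : R, 0 < c &
    forall Rw : nat, (1 <= Rw)%N ->
    forall N : nat, exists2 n : nat, (N <= n)%N &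
    exists order : seq (edge n),
      [/\ simple_digraph order,
          (size order).+1 = n &
          ((c * (Rw%:R * n%:R
                 * (size order)%:R `^ log2 (3 / 2 * (1 - eps))))%:E
             <= expected_updates Rw eps order)%E].
Proof.
(* There are at most [2 * M] nodes, and bounding the power of [n] costs [h ^+ 2 = 9 / 4]: indeed
   [2 / 9 * 2 * (9 / 4) = 1]. The leftover factor [q] is at most 1. *)
exists (2 / 9); first by rewrite divr_gt0.
(* The requested lower bound on the number of nodes serves as the depth [k]; the graph has
   [2 ^ k.+2 - 1] nodes. *)
move=> Rw _ k; pose M := (2 ^ k.+1)%N; pose n := (M.-1 + M).-1.
have M0 : (0 < M)%N by rewrite expn_gt0.
have kM : (k.+1 < M)%N by rewrite ltn_expl.
have nE : (M.-1 + M = n.+1)%N by rewrite /n; lia.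
exists n.+1; first by lia.
exists (star_order n M.-1 M ++ tree_order n 0 k).
have szE : size (star_order n M.-1 M ++ tree_order n 0 k) = n.
  have := size_tree_order n 0 k; rewrite -/M size_cat size_map size_iota; lia.
split; [exact: star_tree_simple|by rewrite szE|].
have e1 : eps < 1 by lra.
apply: le_trans (expected_updates_star_tree_ge _ eps_gt0 e1 nE).
rewrite szE lee_fin; set q := 1 - eps; set h := (3 / 2 : R).
have [q0 q1] : 0 < q /\ q <= 1 by rewrite /q; split; lra.
(* As [eps < 1 / 3], the exponent is nonnegative, so the power is monotone and [n] may be enlarged
   to [2 ^ k.+2]. *)
have hq1 : 1 <= h * q by rewrite /h /q; lra.
have a0 : 0 <= log2 (h * q).
  by rewrite /log2 divr_ge0// ln_ge0// ler1n.
have nP : n%:R `^ log2 (h * q) <= (h * q) ^+ k.+2.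
  rewrite -powR2_log2 ?(lt_le_trans ltr01)//.
  apply: ge0_ler_powR; rewrite ?nnegrE ?ler0n// ler_nat.
  by rewrite expnS -/M; lia.
have nM : n.+1%:R <= 2 * M%:R :> R by rewrite -natrM ler_nat; lia.
have hk : 0 < h ^+ k by rewrite exprn_gt0// /h divr_gt0.
apply: (@le_trans _ _ (2 / 9 * (Rw%:R * (2 * M%:R) * (h * q) ^+ k.+2))).
  apply: ler_wpM2l; first by rewrite divr_ge0.
  by apply: ler_pM => //; exact: ler_wpM2l.
rewrite exprMn; have -> : h ^+ k.+2 = 9 / 4 * h ^+ k.
  by rewrite !exprS /h; field.
have -> : 2 / 9 * (Rw%:R * (2 * M%:R) * (9 / 4 * h ^+ k * q ^+ k.+2)) =
    M%:R * Rw%:R * (q ^+ k.+1 * h ^+ k) * q.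
  by rewrite (exprSr q k.+1); field.
by rewrite ler_piMr// mulr_ge0// (mulr_ge0 (exprn_ge0 _ (ltW q0)) (ltW hk)).
Qed.
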